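(* Let $\alpha\in\mathbb{R}\setminus\mathbb{Q}$ with continued fraction expansion $\alpha=[a_0;a_1,a_2,\dots]$. Then $\overline{g}(\alpha)=3$ if $a_n=1$ for infinitely many $n$, and $\overline{g}(\alpha)=2$ otherwise.
   Context: On $\mathbb{T}=\mathbb{R}/\mathbb{Z}$ let $dist(x,y)=\min_{t\in\mathbb{Z}}|x-y-t|$. For integers $N\ge1$ and $0\le q\le N$ put $D_q(N)=\min\{dist(q\alpha,k\alpha): 0\le k\le N,k\ne q\}$, let $g(\alpha,N)$ be the number of distinct values among $D_0(N),\dots,D_N(N)$, and $\overline{g}(\alpha)=\limsup_{N\to\infty}g(\alpha,N)$. *)

(* Defs.v *)
From mathcomp Require Export all_boot all_order all_algebra.
From mathcomp Require Export all_classical all_reals all_analysis.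

Set Implicit Arguments.
Unset Strict Implicit.
Unset Printing Implicit Defensive.

Import Order.TTheory GRing.Theory Num.Theory.

Local Open Scope classical_set_scope.
Local Open Scope ring_scope.

Section NearestNeighbours.
Variable R : realType.
Implicit Types (x y alpha : R) (q N : nat).

(* Points of R/Z are given by real representatives. The set is nonempty and
   bounded below and its infimum is attained, so inf is the minimum. *)
Definition circle_dist x y : R :=
  inf [set `|x - y - t%:~R| | t in [set: int]].

(* For N >= 1 the set is finite and nonempty, so inf is the minimum; the value
   at N = 0 is irrelevant, as only the limit N --> oo is considered. *)
Definition nn_dist alpha N q : R :=
  inf [set circle_dist (q%:R * alpha) (k%:R * alpha)
      | k in [set k : nat | (k <= N)%N /\ k <> q]].

Definition nn_count alpha N : nat :=
  size (undup [seq nn_dist alpha N q | q <- iota 0 N.+1]).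

Definition nn_count_limsup alpha : \bar R :=
  limn_esup (fun N => (nn_count alpha N)%:R%:E).

(* Complete quotients: alpha_0 = alpha, alpha_(n+1) = 1 / (alpha_n - floor
   alpha_n). For irrational alpha no denominator vanishes. *)
Fixpoint complete_quotient alpha (n : nat) : R :=
  if n is m.+1 then
    let x := complete_quotient alpha m in (x - (Num.floor x)%:~R)^-1
  else alpha.

(* The a_n of the regular continued fraction alpha = [a_0; a_1, a_2, ...]. *)
Definition partial_quotient alpha (n : nat) : int :=
  Num.floor (complete_quotient alpha n).

End NearestNeighbours.

(* Main.v *)
(* The distance from q alpha to k alpha depends only on |q - k|, so D_q(N) is
   the minimum of ||m alpha|| over 1 <= m <= max(q, N - q). As q varies this
   bound runs through [ceil(N/2), N], and the running minimum drops exactly at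
   the convergent denominators q_n, so g(alpha, N) is one plus the number of
   q_n in (ceil(N/2), N]. As q_(n+2) >= 2 q_n there are at most two of these;
   q_n and q_(n+1) can both occur only if q_(n+1) < 2 q_n, i.e. a_(n+1) = 1,
   and then, for n large, they do for N = q_(n+1). With N = q_n there is at
   least one. *)
Require Import Defs.
From mathcomp Require Import zify ring lra.

Set Implicit Arguments.
Unset Strict Implicit.
Unset Printing Implicit Defensive.

Import Order.TTheory GRing.Theory Num.Theory.
Local Open Scope classical_set_scope.
Local Open Scope ring_scope.

Lemma limf_esup_le (T : choiceType) (X : filteredType T) (R : realType)
    (f : X -> \bar R) (F : set_system X) (l : \bar R) :
  (\forall x \near F, (f x <= l)%E) -> (limf_esup f F <= l)%E.
Proof.
move=> fl; apply: (@le_trans _ _ (ereal_sup (f @` [set x | (f x <= l)%E]))).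
  by apply: ereal_inf_lbound; exists [set x | (f x <= l)%E].
by apply: ge_ereal_sup => _ [x /= fx <-].
Qed.

Lemma limf_esup_ge (T : choiceType) (X : filteredType T) (R : realType)
    (f : X -> \bar R) (F : set_system X) (l : \bar R) :
  (forall V, F V -> exists2 x, V x & (l <= f x)%E) -> (l <= limf_esup f F)%E.
Proof.
move=> lf; apply: le_ereal_inf_tmp => _ [V /lf[x Vx lfx] <-].
by apply: le_trans lfx _; apply: ereal_sup_ubound; exists x.
Qed.

Lemma finite_set_sub_II (A : set nat) :
  finite_set A -> exists n, A `<=` `I_n.
Proof.
move=> /finite_seqP[s ->]; exists (\max_(i <- s) i).+1 => m /= ms.
by rewrite ltnS; apply: (@leq_bigmax_seq _ s xpredT (fun i : nat => i)).
Qed.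

Lemma irrational_nint (R : realType) (x : R) :
  irrational x -> x \isn't a Num.int.
Proof.
by move=> xirr; apply/negP => /intrP[m xm]; apply: xirr; exists m%:~R;
  rewrite ?ratr_int.
Qed.

Lemma irrational_invB_int (R : realType) (x : R) (m : int) :
  irrational x -> irrational (x - m%:~R)^-1.
Proof.
move=> xirr [q _ qE]; apply: xirr; exists (m%:~R + q^-1) => //.
by rewrite rmorphD/= fmorphV/= qE invrK ratr_int addrC subrK.
Qed.

Lemma ler_norm_sub_opposite (R : realDomainType) (x y : R) :
  x * y <= 0 -> `|x| <= `|x - y|.
Proof.
case: (ltrgt0P x) => [x0|x0|-> _]; last exact: normr_ge0.
  by rewrite pmulr_rle0// => y0; rewrite ler_normr; apply/orP; left; lra.
by rewrite nmulr_rle0// => y0; rewrite ler_normr; apply/orP; right; lra.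
Qed.

Lemma opposite_signs_of_small_lincomb (a b : nat) (x y : int) :
  0 < x * a%:Z + y * b%:Z < b%:Z -> x != 0 /\ x * y <= 0.
Proof.
move=> /andP[pos small]; have [y_le0|y_ge1] : y <= 0 \/ 1 <= y by lia.
  have x_gt0 : 0 < x by nia.
  by split; [rewrite gt_eqF | rewrite mulr_ge0_le0// ltW].
have x_lt0 : x < 0 by nia.
by split; [rewrite lt_eqF | rewrite mulr_le0_ge0// ?ltW; lia].
Qed.

Section NearestMultiples.
Variable R : realType.
Implicit Types (x y e alpha : R) (t : int) (q m M N : nat).

Definition dist_int x : R := inf [set `|x - t%:~R| | t in [set: int]].

Lemma circle_distE x y : circle_dist x y = dist_int (x - y).
Proof. by []. Qed.

Lemma dist_int_ge x e : (forall t, e <= `|x - t%:~R|) -> e <= dist_int x.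
Proof.
move=> ext; apply: lb_le_inf; first by exists `|x - 0%:~R|; exists 0.
by move=> _ [t _ <-].
Qed.

Lemma dist_int_ge0 x : 0 <= dist_int x.
Proof. exact: dist_int_ge. Qed.

Lemma dist_int_le x t : dist_int x <= `|x - t%:~R|.
Proof. by apply: ge_inf; [exists 0 => _ [u _ <-] | exists t]. Qed.

Lemma dist_intN x : dist_int (- x) = dist_int x.
Proof.
have le_distN y : dist_int y <= dist_int (- y).
  apply: dist_int_ge => t; rewrite -normrN opprB opprK addrC.
  by rewrite -[t]opprK rmorphN /= dist_int_le.
by apply/le_anti; rewrite le_distN andbT -{2}[x]opprK le_distN.
Qed.

Definition min_multiple_dist alpha M : R :=
  inf [set dist_int (m%:R * alpha) | m in [set m | (0 < m <= M)%N]].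

Lemma min_multiple_dist_ge alpha M e : (0 < M)%N ->
  (forall m, (0 < m <= M)%N -> e <= dist_int (m%:R * alpha)) ->
  e <= min_multiple_dist alpha M.
Proof.
move=> M0 eM; apply: lb_le_inf => [|_ [m mM <-]]; last exact: eM.
by exists (dist_int (M%:R * alpha)); exists M; rewrite //= M0 leqnn.
Qed.

Lemma min_multiple_dist_le alpha M m : (0 < m <= M)%N ->
  min_multiple_dist alpha M <= dist_int (m%:R * alpha).
Proof.
move=> mM; apply: ge_inf; last by exists m.
by exists 0 => _ [k _ <-]; apply: dist_int_ge0.
Qed.

Lemma nn_distE alpha N q : (q <= N)%N ->
  nn_dist alpha N q = min_multiple_dist alpha (maxn q (N - q)).
Proof.
move=> qN; congr inf; apply/seteqP; split=> [_ [k [kN kq] <-]|_ [m /= mM <-]].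
  rewrite circle_distE -mulrBl.
  have [ltkq|ltqk|/esym//] := ltngtP k q.
    by exists (q - k)%N; [rewrite /=; lia | rewrite natrB// ltnW].
  exists (k - q)%N; first by rewrite /=; lia.
  by rewrite -dist_intN -mulNr natrB ?opprB// ltnW.
have [mq|qm] := leqP m q.
  exists (q - m)%N; first by split; lia.
  by rewrite circle_distE -mulrBl -natrB ?leq_subr// subKn.
exists (q + m)%N; first by split; lia.
by rewrite circle_distE -mulrBl -dist_intN -mulNr opprB natrD addrC addKr.
Qed.

Lemma nn_countE alpha N : nn_count alpha N =
  size (undup [seq min_multiple_dist alpha M
              | M <- iota (uphalf N) (N./2).+1]).
Proof.
apply/perm_size/perm_undup => x; apply/mapP/mapP => -[].
  move=> q; rewrite mem_iota => qN ->; rewrite nn_distE; last by lia.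
  by exists (maxn q (N - q)); rewrite // mem_iota; lia.
move=> M; rewrite mem_iota => MN ->; exists M; first by rewrite mem_iota; lia.
by rewrite nn_distE; [congr min_multiple_dist |]; lia.
Qed.

End NearestMultiples.

Section Convergents.
Variables (R : realType) (alpha : R).

(* The indices are shifted by one, so that the recursion starts from
   q_(-1) = 0 and p_(-1) = 1: conv_den n and conv_num n are q_(n-1) and
   p_(n-1), and conv_err n is |q_(n-1) alpha - p_(n-1)|. *)
Fixpoint conv_den (n : nat) : nat :=
  if n is m.+1 then
    if m is k.+1 then
      (`|partial_quotient alpha m| * conv_den m + conv_den k)%N
    else 1%N
  else 0%N.

Fixpoint conv_num (n : nat) : int :=
  if n is m.+1 then
    if m is k.+1 then partial_quotient alpha m * conv_num m + conv_num k
    else partial_quotient alpha 0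
  else 1.

Fixpoint conv_err (n : nat) : R :=
  if n is m.+1 then conv_err m / complete_quotient alpha n else 1.

Arguments conv_den : simpl never.
Arguments conv_num : simpl never.
Arguments conv_err : simpl never.

Lemma conv_denSS n : conv_den n.+2 =
  (`|partial_quotient alpha n.+1| * conv_den n.+1 + conv_den n)%N.
Proof. by []. Qed.

Lemma conv_numSS n : conv_num n.+2 =
  partial_quotient alpha n.+1 * conv_num n.+1 + conv_num n.
Proof. by []. Qed.

Lemma conv_errS n : conv_err n.+1 = conv_err n / complete_quotient alpha n.+1.
Proof. by []. Qed.

Hypothesis alpha_irr : irrational alpha.

Lemma complete_quotient_irrational n : irrational (complete_quotient alpha n).
Proof. by elim: n => [//|n IHn]; apply: irrational_invB_int. Qed.

Lemma complete_quotient_gt1 n : 1 < complete_quotient alpha n.+1.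
Proof.
rewrite /= invf_gt1; first by rewrite ltrBlDr addrC -intrD1 floorD1_gt.
rewrite subr_gt0 lt_neqAle floor_le andbT -intrEfloor.
exact/irrational_nint/complete_quotient_irrational.
Qed.

Lemma partial_quotient_ge1 n : 1 <= partial_quotient alpha n.+1.
Proof. by rewrite floor_ge_int ltW// complete_quotient_gt1. Qed.

Lemma leq_conv_denD n : (conv_den n.+1 + conv_den n <= conv_den n.+2)%N.
Proof.
rewrite conv_denSS leq_add2r leq_pmull// absz_gt0.
by apply: lt0r_neq0; apply: lt_le_trans (partial_quotient_ge1 n).
Qed.

Lemma conv_den_gt0 n : (0 < conv_den n.+1)%N.
Proof.
elim: n => [//|n IHn]; apply: leq_trans (leq_conv_denD n).
exact: ltn_addr.
Qed.

Lemma conv_den_homo : {homo conv_den : m n / (m <= n)%N}.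
Proof.
apply: homo_leq => // [|[//|n]]; first exact: leq_trans.
exact: leq_trans (leq_addr _ _) (leq_conv_denD n).
Qed.

Lemma conv_den_ltS n : (conv_den n.+2 < conv_den n.+3)%N.
Proof.
apply: leq_trans (leq_conv_denD n.+1).
by rewrite -addn1 leq_add2l conv_den_gt0.
Qed.

Lemma conv_den_ge n : (n <= conv_den n.+1)%N.
Proof.
elim: n => [//|[|n] IHn]; first exact: conv_den_gt0.
exact: leq_ltn_trans IHn (conv_den_ltS n).
Qed.

Lemma conv_den_interval M :
  exists n, (conv_den n <= M < conv_den n.+1)%N.
Proof.
have exM : exists n, (M < conv_den n)%N by exists M.+2; apply: conv_den_ge.
case: (ex_minnP exM) => -[//|n] Mn minn; exists n; rewrite Mn andbT leqNgt.
by apply/negP => /minn; rewrite ltnn.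
Qed.

Lemma conv_den_index_leq M m n :
  (conv_den m <= M < conv_den n.+1)%N -> (m <= n)%N.
Proof.
move=> /andP[mM Mn]; rewrite leqNgt; apply/negP => /conv_den_homo nm.
by have := leq_trans Mn (leq_trans nm mM); rewrite ltnn.
Qed.

Lemma double_conv_den_leSS n : ((conv_den n).*2 <= conv_den n.+2)%N.
Proof.
rewrite -addnn (leq_trans _ (leq_conv_denD n))// leq_add2r.
exact/conv_den_homo.
Qed.

Lemma double_conv_den_leS n : partial_quotient alpha n.+1 <> 1 ->
  ((conv_den n.+1).*2 <= conv_den n.+2)%N.
Proof.
have := partial_quotient_ge1 n => a_ge1 a_neq1.
by rewrite conv_denSS -mul2n (leq_trans _ (leq_addr _ _))// leq_mul2r; lia.
Qed.

Lemma conv_det n :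
  (conv_den n.+1)%:Z * conv_num n - (conv_den n)%:Z * conv_num n.+1
  = (-1) ^+ n.
Proof.
elim: n => [|n IHn]; first by rewrite /conv_den /conv_num; ring.
rewrite conv_denSS conv_numSS exprS -IHn PoszD PoszM gez0_abs; last first.
  exact: le_trans (partial_quotient_ge1 n).
by ring.
Qed.

Lemma conv_basis n (m t : int) : exists x y : int,
  m = x * (conv_den n)%:Z + y * (conv_den n.+1)%:Z /\
  t = x * conv_num n + y * conv_num n.+1.
Proof.
pose s : int := (-1) ^+ n.
have detM z : z = s * ((conv_den n.+1)%:Z * conv_num n
                       - (conv_den n)%:Z * conv_num n.+1) * z.
  by rewrite conv_det -expr2 sqrr_sign mul1r.
exists (s * ((conv_den n.+1)%:Z * t - conv_num n.+1 * m)).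
exists (s * (conv_num n * m - (conv_den n)%:Z * t)).
by split; rewrite [LHS]detM; ring.
Qed.

Lemma conv_err_gt0 n : 0 < conv_err n.
Proof.
elim: n => [//|n IHn]; rewrite conv_errS divr_gt0//.
exact: lt_trans (complete_quotient_gt1 n).
Qed.

Lemma conv_err_ltS n : conv_err n.+1 < conv_err n.
Proof.
rewrite conv_errS ltr_pdivrMr; last exact: lt_trans (complete_quotient_gt1 n).
by rewrite ltr_pMr ?conv_err_gt0 ?complete_quotient_gt1.
Qed.

Lemma conv_err_inj : injective conv_err.
Proof.
have conv_err_lt : {homo conv_err : m n / (m < n)%N >-> n < m}.
  by apply: homo_ltn conv_err_ltS => y x z yx zy; apply: lt_trans zy yx.
by move=> m n emn; case: (ltngtP m n) => // /conv_err_lt;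
  rewrite emn ltxx.
Qed.

Lemma conv_errSS n : conv_err n.+2 =
  conv_err n - (partial_quotient alpha n.+1)%:~R * conv_err n.+1.
Proof.
have cq0 : complete_quotient alpha n.+1 != 0.
  by apply: lt0r_neq0; apply: lt_trans (complete_quotient_gt1 n).
rewrite (conv_errS n.+1) [complete_quotient alpha n.+2]/= invrK.
rewrite -/(complete_quotient alpha n.+1) -/(partial_quotient alpha n.+1).
by rewrite conv_errS; field.
Qed.

Lemma conv_errE n :
  (conv_den n)%:R * alpha - (conv_num n)%:~R = (-1) ^+ n.+1 * conv_err n.
Proof.
elim/ltn_ind: n => -[|[|n]] IHn.
- by rewrite /conv_den /conv_num /conv_err; ring.
- by rewrite /conv_den /conv_num /conv_err /= invrK /partial_quotient /=; ring.
rewrite conv_errSS conv_denSS conv_numSS natrD natrM rmorphD rmorphM /=.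
rewrite natr_absz ger0_norm; last exact: le_trans (partial_quotient_ge1 n).
set a := (partial_quotient alpha n.+1)%:~R.
transitivity (a * ((conv_den n.+1)%:R * alpha - (conv_num n.+1)%:~R)
  + ((conv_den n)%:R * alpha - (conv_num n)%:~R)); first by ring.
by rewrite !IHn// !exprS; ring.
Qed.

Lemma conv_err_norm n :
  `|(conv_den n)%:R * alpha - (conv_num n)%:~R| = conv_err n.
Proof. by rewrite conv_errE normrMsign gtr0_norm// conv_err_gt0. Qed.

Lemma conv_err_lincomb n (x y : int) :
  `|(x * (conv_den n)%:Z + y * (conv_den n.+1)%:Z)%:~R * alpha
    - (x * conv_num n + y * conv_num n.+1)%:~R|
  = `|x%:~R * conv_err n - y%:~R * conv_err n.+1|.
Proof.
rewrite -[RHS](normrMsign n.+1) !rmorphD !rmorphM /=; congr `|_|.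
transitivity (x%:~R * ((conv_den n)%:R * alpha - (conv_num n)%:~R)
  + y%:~R * ((conv_den n.+1)%:R * alpha - (conv_num n.+1)%:~R)).
  by rewrite -!pmulrn; ring.
by rewrite !conv_errE !exprS; ring.
Qed.

(* In the basis given by two consecutive convergents the bound on m forces the
   coordinates of (m, t) to have opposite signs; the two errors have opposite
   signs as well, so their contributions add up. *)
Lemma best_approximation n m (t : int) :
  (0 < m < conv_den n.+1)%N -> conv_err n <= `|m%:R * alpha - t%:~R|.
Proof.
move=> mn; have [x [y [mE ->]]] := conv_basis n m%:Z t.
have [|x0 xy_le0] :=
    @opposite_signs_of_small_lincomb (conv_den n) (conv_den n.+1) x y.
  by rewrite -mE.
rewrite pmulrn mE conv_err_lincomb.
apply: le_trans (ler_norm_sub_opposite _); last first.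
  rewrite mulrACA -rmorphM; apply: mulr_le0_ge0; first by rewrite lerz0.
  by rewrite mulr_ge0// ltW// conv_err_gt0.
rewrite normrM (gtr0_norm (conv_err_gt0 n)) ler_peMl ?(ltW (conv_err_gt0 n))//.
by rewrite norm_intr_ge1 ?intr_int ?intr_eq0.
Qed.

Lemma min_multiple_dist_conv_err n M : (0 < M)%N ->
  (conv_den n <= M < conv_den n.+1)%N ->
  min_multiple_dist alpha M = conv_err n.
Proof.
case: n => [|n] M0 /andP[nM Mn]; first by move: Mn; rewrite ltnNge M0.
apply/le_anti/andP; split; last first.
  apply: min_multiple_dist_ge => // m /andP[m0 mM]; apply: dist_int_ge => t.
  by apply: best_approximation; rewrite m0 (leq_ltn_trans mM).
rewrite -conv_err_norm (le_trans _ (dist_int_le _ _))//.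
by rewrite min_multiple_dist_le// conv_den_gt0.
Qed.

Lemma min_multiple_dist_conv_den n : (2 <= n)%N ->
  min_multiple_dist alpha (conv_den n) = conv_err n.
Proof.
case: n => [|[|n]]// _; apply: min_multiple_dist_conv_err.
  exact: conv_den_gt0.
by rewrite leqnn conv_den_ltS.
Qed.

Lemma nn_count_conv_den_index N m n : (0 < N)%N ->
  (conv_den m <= uphalf N < conv_den m.+1)%N ->
  (conv_den n <= N < conv_den n.+1)%N ->
  nn_count alpha N = (n - m).+1.
Proof.
move=> N0 mN nN; rewrite nn_countE -(size_iota m (n - m).+1).
rewrite -(size_map conv_err) -(@undup_id _ (map conv_err _)); last first.
  by rewrite (map_inj_uniq conv_err_inj) iota_uniq.
apply/perm_size/perm_undup => x; apply/mapP/mapP => -[].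
- move=> M; rewrite mem_iota => MN ->.
  have [k kM] := conv_den_interval M; exists k; last first.
    by rewrite (min_multiple_dist_conv_err _ kM)//; lia.
  have m_le_k : (m <= k)%N by apply: (@conv_den_index_leq (uphalf N)); lia.
  have k_le_n : (k <= n)%N by apply: (@conv_den_index_leq M); lia.
  by rewrite mem_iota; lia.
- move=> k; rewrite mem_iota => kmn ->; have [->|km] := eqVneq k m.
    exists (uphalf N); first by rewrite mem_iota; lia.
    by rewrite (min_multiple_dist_conv_err _ mN)// uphalf_gt0.
  have den_mk : (conv_den m.+1 <= conv_den k)%N by apply: conv_den_homo; lia.
  have den_kn : (conv_den k <= conv_den n)%N by apply: conv_den_homo; lia.
  have m_gt0 : (0 < m)%N.
    apply: (@conv_den_index_leq (uphalf N)).
    by case/andP: mN => _ ->; rewrite andbT uphalf_gt0.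
  exists (conv_den k); first by rewrite mem_iota; lia.
  by rewrite min_multiple_dist_conv_den//; lia.
Qed.

Lemma nn_count_le3 N : (0 < N)%N -> (nn_count alpha N <= 3)%N.
Proof.
move=> N0; have [m mN] := conv_den_interval (uphalf N).
have [n nN] := conv_den_interval N; rewrite (nn_count_conv_den_index N0 mN nN).
have := double_conv_den_leSS m.+1.
by have := @conv_den_index_leq N n m.+2; lia.
Qed.

Lemma nn_count_le2 N n0 :
  (forall n, (n0 <= n)%N -> partial_quotient alpha n <> 1) ->
  (conv_den n0 <= uphalf N)%N -> (0 < N)%N -> (nn_count alpha N <= 2)%N.
Proof.
move=> a_neq1 n0N N0; have [m mN] := conv_den_interval (uphalf N).
have [n nN] := conv_den_interval N; rewrite (nn_count_conv_den_index N0 mN nN).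
have n0m : (n0 <= m)%N by apply: (@conv_den_index_leq (uphalf N)); lia.
have := double_conv_den_leS (a_neq1 m.+1 (leqW n0m)).
by have := @conv_den_index_leq N n m.+1; lia.
Qed.

Lemma nn_count_conv_den_gt m n :
  (uphalf (conv_den n.+2) < conv_den m.+1)%N ->
  (n.+2 - m < nn_count alpha (conv_den n.+2))%N.
Proof.
move=> Nm; have [j jN] := conv_den_interval (uphalf (conv_den n.+2)).
rewrite (nn_count_conv_den_index (conv_den_gt0 _) jN (n := n.+2)); last first.
  by rewrite leqnn conv_den_ltS.
by have := @conv_den_index_leq (uphalf (conv_den n.+2)) j m; lia.
Qed.

Lemma nn_count_conv_den_ge2 n : (2 <= nn_count alpha (conv_den n.+3))%N.
Proof.
have := @nn_count_conv_den_gt n.+2 n.+1; rewrite subSnn; apply.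
by have := conv_den_ltS n; have := conv_den_gt0 n.+1; lia.
Qed.

Lemma nn_count_conv_den_ge3 n : (4 <= n)%N ->
  partial_quotient alpha n.+1 = 1 ->
  (3 <= nn_count alpha (conv_den n.+2))%N.
Proof.
case: n => [|[|n]]// n2 a_eq1.
have := @nn_count_conv_den_gt n.+2 n.+2; rewrite -addn2 addKn; apply.
rewrite addn2 conv_denSS a_eq1.
by have := conv_den_ge n; have := leq_conv_denD n.+1; lia.
Qed.

End Convergents.

Theorem theorem5 (R : realType) (alpha : R) (alpha_irr : irrational alpha) :
  (infinite_set [set n : nat | partial_quotient alpha n = 1] ->
     nn_count_limsup alpha = 3%:E) /\
  (~ infinite_set [set n : nat | partial_quotient alpha n = 1] ->
     nn_count_limsup alpha = 2%:E).
Proof.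
split => [inf1|/contrapT/finite_set_sub_II[n0 fin1]]; apply/le_anti/andP; split.
- apply: limf_esup_le; exists 1%N => // N /= N0.
  by rewrite lee_fin ler_nat nn_count_le3.
- apply: limf_esup_ge => V [N0 _ N0V].
  have [[|m] [a_eq1 /= /negP]] :=
    infinite_setN0 (infinite_setD inf1 (finite_II (N0 + 5))); first by lia.
  rewrite -leqNgt => mN0; exists (conv_den alpha m.+2).
    by apply: N0V; apply: leq_trans (conv_den_ge alpha_irr m.+1); lia.
  by rewrite lee_fin ler_nat nn_count_conv_den_ge3//; lia.
- apply: limf_esup_le; exists (conv_den alpha n0).*2.+1 => // N /= N0.
  rewrite lee_fin ler_nat (@nn_count_le2 _ _ _ _ n0)//; [|lia..].
  by move=> n; rewrite leqNgt => /negP n0n /fin1.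
- apply: limf_esup_ge => V [N0 _ N0V]; exists (conv_den alpha N0.+3).
    by apply: N0V; apply: leq_trans (conv_den_ge alpha_irr N0.+2); lia.
  by rewrite lee_fin ler_nat nn_count_conv_den_ge2.
Qed.
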